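(* Let $L\subseteq\Sigma^*$ be a regular language and $M$ its minimal deterministic finite automaton. Suppose there are words $a,b,c,d,e,f,g,h,i\in\Sigma^*$ and states $q_0,q_a,q_b,q_c,q_{ad},q_{ae},q_{bd},q_{bf},q_{ce},q_{cf}$ of $M$ such that: 1. for each $x\in\{a,b,c\}$, if $M$ reads $x$ in the state $q_0$, its state changes to $q_x$; 2. for each $x\in\{a,b,c\}$, if $M$ reads $x$ in the state $q_x$, its state again becomes $q_x$; 3. for each $x\in\{a,b,c\}$, if $M$ reads any string consisting of $a$, $b$ and $c$ (any element of $(a|b|c)^*$) in the state $q_x$, it moves to a state from which it can return to the same state $q_x$ by reading some (possibly different) string in $(a|b|c)^*$; 4. for each of the six pairs $(x,y)\in\{(a,d),(a,e),(b,d),(b,f),(c,e),(c,f)\}$, if $M$ reads $y$ in the state $q_x$, it moves to the state $q_{xy}$; 5. for each of these six pairs $(x,y)$, if $M$ reads $y$ in the state $q_{xy}$, its state again becomes $q_{xy}$; 6. for each of these six pairs $(x,y)$, if $M$ reads any string in $(d|e|f)^*$ in the state $q_{xy}$, it moves to a state from which it can return to the same state $q_{xy}$ by reading some (possibly different) string in $(d|e|f)^*$; 7. reading $g$ in the state $q_{ad}$, $h$ in the state $q_{bf}$, and $i$ in the state $q_{ce}$ leads to accepting states; reading $h$ in the state $q_{ae}$, $i$ in the state $q_{bd}$, and $g$ in the state $q_{cf}$ leads to rejecting states. Then $L$ is not recognizable by a QFA.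
   Context: $(u|v|w)^*$ is the set of all finite concatenations of copies of the words $u,v,w$. In a deterministic finite automaton (DFA) a state is rejecting if it is not accepting. The minimal automaton of a regular language is the smallest (complete) DFA recognizing it. The state $q_0$ in the claim need not be the starting state of $M$. In the claim, $x,y$ are the names of the words they range over (indices). A 1-way quantum finite automaton (QFA) is a tuple $(Q,\Sigma,V,s,Q_{acc},Q_{rej})$: $Q$ is a finite set of states, $\Sigma$ a finite input alphabet, $s\in Q$ the starting state, $Q_{acc},Q_{rej}\subseteq Q$ are disjoint sets of accepting and rejecting states, and $Q_{non}=Q\setminus(Q_{acc}\cup Q_{rej})$. Let $l_2(Q)$ be the complex Hilbert space with orthonormal basis $\{|q\rangle: q\in Q\}$, and $E_{acc},E_{rej},E_{non}$ the spans of $\{|q\rangle\}$ for $q$ in $Q_{acc},Q_{rej},Q_{non}$ respectively. With endmarkers $\kappa,\$\notin\Sigma$ and $\Gamma=\Sigma\cup\{\kappa,\$\}$, $V$ assigns to each letter $\sigma\in\Gamma$ a unitary map $V_\sigma$ on $l_2(Q)$. On input $w\in\Sigma^*$ the automaton starts in $|s\rangle$ and reads the letters of $\kappa w\$$ in order. Reading $\sigma$ in the current (unnormalized) superposition $\psi$ means: compute $V_\sigma\psi$; the automaton accepts (and halts) with probability the squared norm of the projection of $V_\sigma\psi$ onto $E_{acc}$, rejects (and halts) with probability the squared norm of its projection onto $E_{rej}$, and otherwise continues with the unnormalized superposition equal to the projection of $V_\sigma\psi$ onto $E_{non}$. The probability of accepting (rejecting) $w$ is the sum of these acceptance (rejection)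 probabilities over all letters of $\kappa w\$$. A QFA recognizes $L$ with probability $p>\frac12$ if it accepts every $w\in L$ with probability $\geq p$ and rejects every $w\in\Sigma^*\setminus L$ with probability $\geq p$. $L$ is recognizable by a QFA if this holds for some QFA and some $p>\frac12$. *)

(* Defs.v *)
From HB Require Import structures.
From mathcomp Require Import all_boot all_order all_algebra.
From mathcomp Require Import spectral.
From mathcomp Require Import reals.
From mathcomp Require Import complex.

Set Implicit Arguments.
Unset Strict Implicit.
Unset Printing Implicit Defensive.

Import Order.TTheory GRing.Theory Num.Theory.

Local Open Scope ring_scope.
Local Open Scope complex_scope.

Definition star3 (T : eqType) (u v w s : seq T) : Prop :=
  exists2 ws : seq (seq T), {subset ws <= [:: u; v; w]} & s = flatten ws.

Record dfa (Sigma : finType) := Dfa {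
  dfa_state :> finType;
  dfa_start : dfa_state;
  dfa_accept : {set dfa_state};
  dfa_trans : dfa_state -> Sigma -> dfa_state }.

Definition dfa_read (Sigma : finType) (M : dfa Sigma) (q : M) (w : seq Sigma)
  : M := foldl (@dfa_trans Sigma M) q w.

Definition dfa_recognizes (Sigma : finType) (M : dfa Sigma)
    (L : seq Sigma -> Prop) : Prop :=
  forall w, L w <-> dfa_read (dfa_start M) w \in dfa_accept M.

Definition minimal_dfa (Sigma : finType) (M : dfa Sigma)
    (L : seq Sigma -> Prop) : Prop :=
  dfa_recognizes M L /\
  (forall M' : dfa Sigma, dfa_recognizes M' L -> (#|M| <= #|M'|)%N).

Definition returns_under (Sigma : finType) (M : dfa Sigma)
    (W : seq Sigma -> Prop) (q : M) : Prop :=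
  forall s, W s -> exists2 t, W t & dfa_read (dfa_read q s) t = q.

Inductive tape_letter (Sigma : Type) : Type :=
  | Kappa
  | Dollar
  | Letter of Sigma.

Arguments Kappa {Sigma}.
Arguments Dollar {Sigma}.

(* l_2(Q) is 'cV[R[i]]_#|Q|: the coordinate along |q> has index enum_rank q. *)
Record qfa (R : realType) (Sigma : finType) := Qfa {
  qfa_state : finType;
  qfa_start : qfa_state;
  qfa_acc : {set qfa_state};
  qfa_rej : {set qfa_state};
  qfa_disjoint : [disjoint qfa_acc & qfa_rej];
  qfa_op : tape_letter Sigma -> 'M[R[i]]_#|qfa_state|;
  qfa_op_unitary : forall sigma, qfa_op sigma \is unitarymx }.

Definition ket (R : realType) (Q : finType) (q : Q) : 'cV[R[i]]_#|Q| :=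
  delta_mx (enum_rank q) 0.

Definition span_proj (R : realType) (Q : finType) (S : {set Q})
    (psi : 'cV[R[i]]_#|Q|) : 'cV[R[i]]_#|Q| :=
  \col_k (if enum_val k \in S then psi k 0 else 0).

Definition sqnorm (R : realType) (n : nat) (psi : 'cV[R[i]]_n) : R :=
  \sum_(k < n) (complex.Re (psi k 0) ^+ 2 + complex.Im (psi k 0) ^+ 2).

Definition qfa_non (R : realType) (Sigma : finType) (A : qfa R Sigma)
  : {set qfa_state A} := ~: (qfa_acc A :|: qfa_rej A).

(* Probability that A, reading ws from the unnormalized superposition psi,
   halts by a measurement outcome in E_H; used with H = Q_acc and H = Q_rej. *)
Fixpoint halt_prob (R : realType) (Sigma : finType) (A : qfa R Sigma)
    (H : {set qfa_state A}) (psi : 'cV[R[i]]_#|qfa_state A|)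
    (ws : seq (tape_letter Sigma)) : R :=
  if ws is sigma :: ws' then
    let phi := qfa_op A sigma *m psi in
    sqnorm (span_proj H phi) + halt_prob H (span_proj (qfa_non A) phi) ws'
  else 0.

Definition tape (Sigma : Type) (w : seq Sigma) : seq (tape_letter Sigma) :=
  Kappa :: rcons (map (@Letter Sigma) w) Dollar.

Definition accept_prob (R : realType) (Sigma : finType) (A : qfa R Sigma)
    (w : seq Sigma) : R :=
  halt_prob (qfa_acc A) (ket R (qfa_start A)) (tape w).

Definition reject_prob (R : realType) (Sigma : finType) (A : qfa R Sigma)
    (w : seq Sigma) : R :=
  halt_prob (qfa_rej A) (ket R (qfa_start A)) (tape w).

Definition qfa_recognizes (R : realType) (Sigma : finType) (A : qfa R Sigma)
    (L : seq Sigma -> Prop) (p : R) : Prop :=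
  (forall w, L w -> p <= accept_prob A w) /\
  (forall w, ~ L w -> p <= reject_prob A w).

Definition qfa_recognizable (R : realType) (Sigma : finType)
    (L : seq Sigma -> Prop) : Prop :=
  exists (A : qfa R Sigma) (p : R), 2^-1 < p /\ qfa_recognizes A L p.

(* Main.v *)
Require Import Defs.
From mathcomp Require Import all_boot all_order all_algebra.
From mathcomp Require Import reals.
From mathcomp Require Import spectral complex boolp ring lra.

(* Let W be a monoid of words. A vector splits into a part P v
   whose norm no word of W decreases and a part that some words of W make
   arbitrarily small. Since the words of W are isometries on the range of P,
   recurrence of powers gives, for every x in W, words of x W acting on v almost
   as P. Two consequences:
   - a word of W acts injectively on a class of states of M recurrent under W:
     otherwise two states of M could be reached with almost the same vector P v
     and almost the same acceptance probability so far;
   - hence from q0 there are words leading to qa, qb, qc whose quantum states are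
     all close to the same vector P v, and then single words ud, ue, uf leading
     from qa, qb, qc to the six states q_xy with vectors all close to P' P v.
   The acceptance probability along a path is thus, up to a small error, the sum
   of a term depending on its first word, one depending on its second word and
   one depending on its last word. The three accepted paths adg, bfh, cei and the
   three rejected ones aeh, bdi, cfg use the same nine terms, so the two triples
   have almost equal total acceptance probability. *)

Set Implicit Arguments.
Unset Strict Implicit.
Unset Printing Implicit Defensive.

Import Order.TTheory GRing.Theory Num.Theory.

Local Open Scope ring_scope.
Local Open Scope complex_scope.
Local Open Scope sesquilinear_scope.

(** * Contractions of a finite-dimensional Hilbert space *)

Section InnerProduct.
Variable R : realType.
Implicit Types m n p : nat.

Definition rdot n (x y : 'cV[R[i]]_n) : R := complex.Re ((x^t* *m y) 0 0).

Lemma rdotE n (x y : 'cV[R[i]]_n) :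
  rdot x y = \sum_k (complex.Re (x k 0) * complex.Re (y k 0) +
                     complex.Im (x k 0) * complex.Im (y k 0)).
Proof.
rewrite /rdot mxE raddf_sum; apply: eq_bigr => k _.
rewrite !mxE; case: (x k 0) (y k 0) => [a b] [c d].
by rewrite /= mulNr opprK.
Qed.

Lemma sqnormE n (x : 'cV[R[i]]_n) : sqnorm x = rdot x x.
Proof. by rewrite rdotE /sqnorm; apply: eq_bigr => k _; rewrite !expr2. Qed.

Lemma rdotC n (x y : 'cV[R[i]]_n) : rdot x y = rdot y x.
Proof.
by rewrite !rdotE; apply: eq_bigr => k _; rewrite mulrC [X in _ + X]mulrC.
Qed.

Lemma rdotDr n (x y z : 'cV[R[i]]_n) : rdot x (y + z) = rdot x y + rdot x z.
Proof. by rewrite /rdot mulmxDr mxE raddfD. Qed.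

Lemma rdotNr n (x y : 'cV[R[i]]_n) : rdot x (- y) = - rdot x y.
Proof. by rewrite /rdot mulmxN mxE raddfN. Qed.

Lemma rdot0r n (x : 'cV[R[i]]_n) : rdot x 0 = 0.
Proof. by rewrite /rdot mulmx0 mxE. Qed.

Lemma rdotDl n (x y z : 'cV[R[i]]_n) : rdot (y + z) x = rdot y x + rdot z x.
Proof. by rewrite rdotC rdotDr !(rdotC x). Qed.

Lemma rdotNl n (x y : 'cV[R[i]]_n) : rdot (- y) x = - rdot y x.
Proof. by rewrite rdotC rdotNr (rdotC x). Qed.

Lemma adjmxM m n p (A : 'M[R[i]]_(m, n)) (B : 'M[R[i]]_(n, p)) :
  (A *m B)^t* = B^t* *m A^t*.
Proof. by rewrite trmx_mul map_mxM. Qed.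

Lemma adjmxB m n (A B : 'M[R[i]]_(m, n)) : (A - B)^t* = A^t* - B^t*.
Proof. by rewrite linearB /= map_mxB. Qed.

Lemma adjmx1 n : (1%:M : 'M[R[i]]_n)^t* = 1%:M.
Proof. by rewrite trmx1 map_mx1. Qed.

Lemma rdot_adj m n (A : 'M[R[i]]_(m, n)) x y :
  rdot (A^t* *m x) y = rdot x (A *m y).
Proof. by rewrite /rdot adjmxM trmxCK mulmxA. Qed.

Lemma sqnorm_ge0 n (x : 'cV[R[i]]_n) : 0 <= sqnorm x.
Proof. by apply: sumr_ge0 => k _; rewrite addr_ge0 ?sqr_ge0. Qed.

Lemma sqnorm_eq0 n (x : 'cV[R[i]]_n) : sqnorm x = 0 -> x = 0.
Proof.
move=> x0; apply/colP => k; rewrite mxE.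
have /psumr_eq0P := x0; move=> /(_ (fun k _ => addr_ge0 (sqr_ge0 _) (sqr_ge0 _))).
move=> /(_ k isT)/eqP; rewrite paddr_eq0 ?sqr_ge0// !sqrf_eq0 => /andP[/eqP + /eqP].
by case: (x k 0) => a b /= -> ->.
Qed.

Lemma sqnormD n (x y : 'cV[R[i]]_n) :
  sqnorm (x + y) = sqnorm x + sqnorm y + 2 * rdot x y.
Proof.
by rewrite !sqnormE rdotDl !rdotDr (rdotC y x) mulr_natl mulr2n addrA addrAC -!addrA
  (addrCA (rdot y y)).
Qed.

Lemma sqnormN n (x : 'cV[R[i]]_n) : sqnorm (- x) = sqnorm x.
Proof. by rewrite !sqnormE rdotNl rdotNr opprK. Qed.

Lemma sqnormB n (x y : 'cV[R[i]]_n) :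
  sqnorm (x - y) = sqnorm x + sqnorm y - 2 * rdot x y.
Proof. by rewrite sqnormD sqnormN rdotNr mulrN. Qed.

Lemma sqnorm_distC n (x y : 'cV[R[i]]_n) : sqnorm (x - y) = sqnorm (y - x).
Proof. by rewrite -sqnormN opprB. Qed.

(** Young's inequality; the weight [t] replaces the square roots of the triangle inequality and is
    tuned later. *)
Lemma sqrD_le (t a b : R) : 0 < t ->
  (a + b) ^+ 2 <= (1 + t) * a ^+ 2 + (1 + t^-1) * b ^+ 2.
Proof.
move=> t0; rewrite -subr_ge0.
have -> : (1 + t) * a ^+ 2 + (1 + t^-1) * b ^+ 2 - (a + b) ^+ 2 =
          t * (a - b / t) ^+ 2 by field; rewrite gt_eqF.
by rewrite mulr_ge0 ?sqr_ge0 ?ltW.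
Qed.

Lemma sqnormD_le n (x y : 'cV[R[i]]_n) (t : R) : 0 < t ->
  sqnorm (x + y) <= (1 + t) * sqnorm x + (1 + t^-1) * sqnorm y.
Proof.
move=> t0; rewrite /sqnorm !mulr_sumr -big_split; apply: ler_sum => k _.
rewrite /= mxE; case: (x k 0) (y k 0) => [a b] [c d] /=.
by have := sqrD_le a c t0; have := sqrD_le b d t0; lra.
Qed.

Lemma sqnormD_le2 n (x y : 'cV[R[i]]_n) :
  sqnorm (x + y) <= 2 * sqnorm x + 2 * sqnorm y.
Proof. by have := sqnormD_le x y ltr01; rewrite invr1. Qed.

Lemma rdot_gram m n (A : 'M[R[i]]_(m, n)) x :
  rdot x (A^t* *m A *m x) = sqnorm (A *m x).
Proof. by rewrite -mulmxA rdotC rdot_adj sqnormE. Qed.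

Definition contraction n (T : 'M[R[i]]_n) :=
  forall x : 'cV_n, sqnorm (T *m x) <= sqnorm x.

(** The square of the defect operator of a contraction. Its quadratic form is the squared norm lost
    by [T], so that isometry on a vector becomes a linear equation. *)
Definition defect n (T : 'M[R[i]]_n) : 'M[R[i]]_n := 1%:M - T^t* *m T.

Lemma rdot_defect n (T : 'M[R[i]]_n) x :
  rdot x (defect T *m x) = sqnorm x - sqnorm (T *m x).
Proof.
by rewrite mulmxBl mul1mx rdotDr rdotNr rdot_gram -sqnormE.
Qed.

Lemma defect_adj n (T : 'M[R[i]]_n) : (defect T)^t* = defect T.
Proof. by rewrite adjmxB adjmx1 adjmxM trmxCK. Qed.

(** Expanding gives |x|^2 - 2|Tx|^2 + |T'Tx|^2 with T' the adjoint, and the last term is at most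
    |Tx|^2. *)
Lemma sqnorm_defect_le n (T : 'M[R[i]]_n) x : contraction (T^t*) ->
  sqnorm (defect T *m x) <= sqnorm x - sqnorm (T *m x).
Proof.
move=> cT; rewrite mulmxBl mul1mx sqnormB rdot_gram -mulmxA.
by have := cT (T *m x); lra.
Qed.

Lemma defect_eq0 n (T : 'M[R[i]]_n) x : contraction (T^t*) ->
  sqnorm (T *m x) = sqnorm x -> defect T *m x = 0.
Proof.
move=> cT Tx; apply: sqnorm_eq0; apply/eqP; rewrite eq_le sqnorm_ge0 andbT.
by rewrite (le_trans (sqnorm_defect_le x cT))// Tx subrr.
Qed.

Lemma mulmx_ext m n (A B : 'M[R[i]]_(m, n)) :
  (forall x : 'cV_n, A *m x = B *m x) -> A = B.
Proof.
move=> AB; apply/matrixP => a j.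
by have /colP/(_ a) := AB (delta_mx j 0); rewrite -!colE !mxE.
Qed.

Lemma trace_adj_eq0 n (A : 'M[R[i]]_n) : \tr (A^t* *m A) = 0 -> A = 0.
Proof.
move=> tr0; apply: mulmx_ext => x; rewrite mul0mx.
have colA j : sqnorm (col j A) = complex.Re ((A^t* *m A) j j).
  rewrite sqnormE /rdot !mxE; congr complex.Re; apply: eq_bigr => k _.
  by rewrite !mxE.
have : \sum_j sqnorm (col j A) = 0.
  transitivity (complex.Re (\tr (A^t* *m A))); last by rewrite tr0.
  by rewrite raddf_sum; apply: eq_bigr => j _; exact: colA.
move/psumr_eq0P => /(_ (fun j _ => sqnorm_ge0 _)) col0.
suff -> : A = 0 by rewrite mul0mx.
apply/matrixP => a j; have /sqnorm_eq0/colP/(_ a) := col0 j isT.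
by rewrite !mxE.
Qed.

Definition orthoproj n (P : 'M[R[i]]_n) := P *m P = P /\ P^t* = P.

Lemma orthoproj_split n (P : 'M[R[i]]_n) x : orthoproj P ->
  sqnorm (P *m x) + sqnorm (x - P *m x) = sqnorm x.
Proof.
case=> PP Pa; rewrite sqnormB -(rdot_gram P x) Pa PP.
by lra.
Qed.

(* If T is isometric on the range of P and maps it to itself, then T P is a
   partial isometry of the range onto itself (its range projection has the same
   trace as P), which forces T to preserve the orthogonal complement too. *)
Lemma isometry_commutes_proj n (P T : 'M[R[i]]_n) : orthoproj P ->
  P *m T *m P = T *m P -> defect T *m P = 0 -> P *m T = T *m P.
Proof.
case=> PP Pa PTP DTP.
have TTP : T^t* *m T *m P = P.
  by apply/esym/eqP; rewrite -subr_eq0 -[X in X - _]mul1mx -mulmxBl; apply/eqP.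
have PTT : P *m T^t* *m T = P.
  by have := congr1 (fun A => A^t*) TTP; rewrite !adjmxM !trmxCK Pa mulmxA.
have [A AE] : exists A, A = T *m P by exists (T *m P).
have Aa : A^t* = P *m T^t* by rewrite AE adjmxM Pa.
have AaA : A^t* *m A = P by rewrite Aa AE mulmxA PTT PP.
have PA : P *m A = A by rewrite AE mulmxA.
have AaP : A^t* *m P = A^t*.
  by have := congr1 (fun A => A^t*) PA; rewrite adjmxM Pa.
have AP : A *m P = A by rewrite AE -mulmxA PP.
pose Q := P - A *m A^t*.
have Qa : Q^t* = Q by rewrite adjmxB adjmxM trmxCK Pa.
have QQ : Q *m Q = Q.
  rewrite mulmxBl !mulmxBr PP -!mulmxA AaP (mulmxA P) PA.
  by rewrite (mulmxA (A^t*)) AaA (mulmxA A P) AP subrr subr0.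
have /eqP : Q = 0.
  by apply: trace_adj_eq0; rewrite Qa QQ linearB /= mxtrace_mulC AaA subrr.
rewrite subr_eq0 => /eqP QE.
by rewrite -AE QE -mulmxA Aa PTT AP.
Qed.

Lemma unitary_adjmxK n (U : 'M[R[i]]_n) : U \is unitarymx -> U^t* *m U = 1%:M.
Proof. by rewrite -trmxC_unitary => /unitarymxP; rewrite trmxCK. Qed.

Lemma sqnorm_unitary n (U : 'M[R[i]]_n) x : U \is unitarymx ->
  sqnorm (U *m x) = sqnorm x.
Proof.
by move=> /unitary_adjmxK UU; rewrite -rdot_gram UU mul1mx -sqnormE.
Qed.

Lemma diag_mx_adj n (d : 'rV[R[i]]_n) : (diag_mx d)^t* = diag_mx (map_mx Num.conj d).
Proof. by rewrite tr_diag_mx map_diag_mx. Qed.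

Lemma mul_diag_colE n (d : 'rV[R[i]]_n) (y : 'cV[R[i]]_n) k :
  (diag_mx d *m y) k 0 = d 0 k * y k 0.
Proof. by rewrite mul_diag_mx mxE. Qed.

Lemma rdot_diag n (d : 'rV[R[i]]_n) (y : 'cV[R[i]]_n) :
  rdot y (diag_mx d *m y) = \sum_k complex.Re (d 0 k) *
    (complex.Re (y k 0) ^+ 2 + complex.Im (y k 0) ^+ 2).
Proof.
rewrite rdotE; apply: eq_bigr => k _; rewrite mul_diag_colE.
by case: (d 0 k) (y k 0) => [a b] [u v] /=; ring.
Qed.

(** The spectral theorem makes [H] diagonal with non-negative eigenvalues: [P] is the spectral
    projection of the eigenvalue 0, and [delta] comes from the gap above it. *)
Lemma kernel_projection n (H : 'M[R[i]]_n) : H^t* = H ->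
  (forall x, 0 <= rdot x (H *m x)) ->
  (forall x, rdot x (H *m x) = 0 -> H *m x = 0) ->
  exists P delta, [/\ orthoproj P, 0 < delta, H *m P = 0,
    (forall x : 'cV_n, H *m x = 0 -> P *m x = x) &
    (forall x : 'cV_n, P *m x = 0 -> delta * sqnorm x <= rdot x (H *m x))].
Proof.
move=> Ha H_ge0 H_eq0.
have /orthomx_spectralP : H \is normalmx by apply/normalmxP; rewrite Ha.
have := spectral_unitarymx H.
move: (spectralmx H) (spectral_diag H) => U d Uu; rewrite invmx_unitary// => HE.
have UU := unitary_adjmxK Uu; have /unitarymxP UU' := Uu.
pose chi : 'rV[R[i]]_n := \row_k (d 0 k == 0)%:R.
have rdotH x : rdot x (H *m x) = rdot (U *m x) (diag_mx d *m (U *m x)).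
  by rewrite HE -!mulmxA -rdot_adj trmxCK.
have d_ge0 k : d 0 k != 0 -> 0 < complex.Re (d 0 k).
  move=> dk; pose x : 'cV[R[i]]_n := U^t* *m delta_mx k 0.
  have Ux : U *m x = delta_mx k 0 by rewrite mulmxA UU' mul1mx.
  have Rdk : rdot x (H *m x) = complex.Re (d 0 k).
    rewrite rdotH Ux rdot_diag (bigD1 k)//= big1 => [|j /negPf jk].
      by rewrite !mxE !eqxx /= expr1n expr0n /= !addr0 mulr1.
    by rewrite !mxE jk /= expr0n /= addr0 mulr0.
  rewrite lt_def -Rdk H_ge0 andbT; apply: contra dk => /eqP/H_eq0 Hx.
  have : U *m (H *m x) = 0 by rewrite Hx mulmx0.
  rewrite HE -!mulmxA Ux (mulmxA U) UU' mul1mx => /colP/(_ k).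
  by rewrite mul_diag_colE !mxE !eqxx mulr1 => ->.
exists (U^t* *m diag_mx chi *m U).
(* The least non-zero eigenvalue, capped at 1, which covers [H = 0]. *)
exists (\big[Num.min/1]_(k | d 0 k != 0) complex.Re (d 0 k)).
have chiE k : chi 0 k = (d 0 k == 0)%:R by rewrite mxE.
split.
- split.
    rewrite -!mulmxA (mulmxA U) UU' mul1mx (mulmxA (diag_mx chi)).
    congr (_ *m (_ *m _)); rewrite mulmx_diag; congr diag_mx.
    by apply/rowP => k; rewrite !mxE; case: (d 0 k == 0); rewrite /= ?mulr0 ?mulr1.
  rewrite !adjmxM trmxCK diag_mx_adj -mulmxA; congr (_ *m (diag_mx _ *m _)).
  by apply/rowP => k; rewrite !mxE; case: (d 0 k == 0); rewrite /= ?rmorph0 ?rmorph1.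
- by apply: lt_bigmin => // k /d_ge0.
- rewrite HE -!mulmxA (mulmxA U) UU' mul1mx (mulmxA (diag_mx d)) mulmx_diag.
  rewrite (_ : \row_j _ = 0) ?linear0 ?mul0mx ?mulmx0//.
  apply/rowP => k; rewrite !mxE.
  by case: eqP => [->|_]; rewrite ?mul0r ?mulr0.
- move=> x Hx; have : U *m (H *m x) = 0 by rewrite Hx mulmx0.
  rewrite HE -!mulmxA (mulmxA U) UU' mul1mx => /colP dUx.
  suff chiUx : diag_mx chi *m (U *m x) = U *m x.
    by rewrite chiUx mulmxA UU mul1mx.
  apply/colP => k; have := dUx k; rewrite !mul_diag_colE chiE [in RHS]mxE.
  case: eqP => [_|/eqP dk /eqP]; first by rewrite mul1r.
  by rewrite mulf_eq0 (negPf dk) => /eqP ->; rewrite mulr0.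
- move=> x Px; rewrite rdotH rdot_diag -(sqnorm_unitary x Uu) /sqnorm mulr_sumr.
  have : U *m (U^t* *m diag_mx chi *m U *m x) = 0 by rewrite Px mulmx0.
  rewrite -!mulmxA (mulmxA U) UU' mul1mx => /colP cUx.
  apply: ler_sum => k _; have := cUx k; rewrite mul_diag_colE chiE [in RHS]mxE.
  case: eqP => [_|/eqP dk _].
    by rewrite mul1r => ->; rewrite /= expr0n /= addr0 !mulr0.
  by rewrite ler_wpM2r ?addr_ge0 ?sqr_ge0//; apply: bigmin_le_cond.
Qed.

End InnerProduct.

(** * Near-repetitions in bounded sequences *)

Section Pigeonhole.

Lemma pigeonhole (T : finType) (f : nat -> T) :
  exists i j, (i < j)%N /\ f i = f j.
Proof.
pose g (k : 'I_#|T|.+1) := f k.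
have /injectivePn[i [j ij gij]] : ~~ injectiveb g.
  by apply/injectiveP => /leq_card; rewrite card_ord ltnn.
have : (i != j :> nat) by apply: contra ij => /eqP/val_inj ->.
by rewrite neq_ltn => /orP[] ?; [exists i, j | exists j, i].
Qed.

Variable R : realType.

Lemma truncn_div_close (s x y : R) : 0 < s -> 0 <= x -> 0 <= y ->
  Num.truncn (x / s) = Num.truncn (y / s) -> (x - y) ^+ 2 <= s ^+ 2.
Proof.
move=> s0 x0 y0 xy.
have /andP[] := truncn_itv (divr_ge0 x0 (ltW s0)).
have /andP[] := truncn_itv (divr_ge0 y0 (ltW s0)).
rewrite xy; move: (Num.truncn _) => k.
rewrite -natr1 !(ler_pdivlMr, ltr_pdivrMr)//; nra.
Qed.

(** Truncation needs non-negative numbers, hence the shift; [B + 1] bounds |a| without a square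
    root. *)
Lemma sqr_bound_itv (a B : R) : a ^+ 2 <= B -> 0 <= a + (B + 1) <= 2 * (B + 1).
Proof. by move=> aB; have a0 := sqr_ge0 a; apply/andP; split; nra. Qed.

Lemma sqr_coord_le n (x : 'cV[R[i]]_n) k :
  complex.Re (x k 0) ^+ 2 <= sqnorm x /\ complex.Im (x k 0) ^+ 2 <= sqnorm x.
Proof.
have xk : complex.Re (x k 0) ^+ 2 + complex.Im (x k 0) ^+ 2 <= sqnorm x.
  rewrite /sqnorm (bigD1 k)//= lerDl sumr_ge0// => j _.
  by rewrite addr_ge0 ?sqr_ge0.
by split; apply: le_trans xk; rewrite ?lerDl ?lerDr sqr_ge0.
Qed.

Lemma bounded_near_repeat n (x : nat -> 'cV[R[i]]_n) (B eps : R) : 0 < eps ->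
  (forall j, sqnorm (x j) <= B) ->
  exists i j, (i < j)%N /\ sqnorm (x i - x j) <= eps.
Proof.
move=> e0 xB.
(* There are [2n] real coordinates, each off by at most [s]. The cap at 1 gives [s^2 <= s]; the
   successor avoids division by 0 when [n = 0]. *)
pose s : R := Num.min 1 (eps / (n.*2.+1)%:R).
have s0 : 0 < s by rewrite lt_min ltr01 divr_gt0.
have B0 : 0 <= B by exact: le_trans (sqnorm_ge0 _) (xB 0%N).
pose co j (c : 'I_n * bool) : R :=
  (if c.2 then complex.Re (x j c.1 0) else complex.Im (x j c.1 0)) + (B + 1).
have co_itv j c : 0 <= co j c <= 2 * (B + 1).
  apply: sqr_bound_itv; have [reB imB] := sqr_coord_le (x j) c.1.
  by case: c.2; exact: le_trans (xB j).
pose m := Num.truncn (2 * (B + 1) / s).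
pose code j : {ffun 'I_n * bool -> 'I_m.+1} :=
  [ffun c => inord (Num.truncn (co j c / s))].
have [a [b [ab /ffunP code_ab]]] := pigeonhole code.
exists a, b; split=> //.
have close c : (co a c - co b c) ^+ 2 <= s ^+ 2.
  have /andP[a0 a1] := co_itv a c; have /andP[b0 b1] := co_itv b c.
  apply: truncn_div_close => //; have := congr1 val (code_ab c).
  by rewrite !ffunE /= !inordK// ltnS le_truncn// ler_pM2r ?invr_gt0.
have -> : eps = (eps / n.*2.+1%:R) * n.*2.+1%:R by rewrite divfK ?pnatr_eq0.
apply: (@le_trans _ _ (\sum_(k < n) (2 * s ^+ 2))).
  apply: ler_sum => k _; rewrite !mxE.
  have := close (k, true); have := close (k, false); rewrite /co /=.
  case: (x a k 0) (x b k 0) => [p q] [p' q'] /=.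
  have -> : p + (B + 1) - (p' + (B + 1)) = p - p' by ring.
  have -> : q + (B + 1) - (q' + (B + 1)) = q - q' by ring.
  lra.
rewrite sumr_const card_ord -[leLHS]mulr_natr.
have s1 : s <= 1 by rewrite ge_min lexx.
have se : s <= eps / n.*2.+1%:R by rewrite ge_min lexx orbT.
have ss : s ^+ 2 <= eps / n.*2.+1%:R.
  by rewrite (le_trans _ se)// expr2 ler_piMr// ltW.
move: ss; rewrite -[n.*2.+1%:R]natr1 -mul2n [(2 * n)%:R]natrM => ss.
have s2 := sqr_ge0 s; have n0 : 0 <= n%:R :> R by [].
have -> : 2 * s ^+ 2 * n%:R = s ^+ 2 * (2 * n%:R) by ring.
have n2 : 0 <= 2 * n%:R :> R by rewrite mulr_ge0.
by apply: ler_pM => //; rewrite lerDl.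
Qed.

End Pigeonhole.

(** * Monoids of contractions *)

Section ContractionMonoid.
Variables (R : realType) (n : nat) (S : eqType) (T : seq S -> 'M[R[i]]_n).
Hypotheses (T_nil : T [::] = 1%:M) (T_cat : forall u v, T (u ++ v) = T v *m T u).
Hypotheses (T_contr : forall w, contraction (T w)).
Hypotheses (T_adj_contr : forall w, contraction ((T w)^t*)).
Variable W : seq S -> Prop.
Hypotheses (W_nil : W [::]) (W_cat : forall u v, W u -> W v -> W (u ++ v)).

(** The quadratic form of [H ws] adds up the losses of the words of [ws], so its kernel consists of
    the vectors on which all of them are isometric. *)
Let H (ws : seq (seq S)) : 'M[R[i]]_n := \sum_(w <- ws) defect (T w).

Let H_adj ws : (H ws)^t* = H ws.
Proof.
rewrite /H; elim/big_ind: _ => [|A B AA BB|w _]; last exact: defect_adj.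
  by rewrite trmx0 map_mx0.
by rewrite linearD /= map_mxD AA BB.
Qed.

Let rdot_H ws x :
  rdot x (H ws *m x) = \sum_(w <- ws) (sqnorm x - sqnorm (T w *m x)).
Proof.
rewrite /H; elim: ws => [|w ws IH]; first by rewrite !big_nil mul0mx rdot0r.
by rewrite !big_cons mulmxDl rdotDr rdot_defect IH.
Qed.

Let drop_ge0 w x : 0 <= sqnorm x - sqnorm (T w *m x).
Proof. by rewrite subr_ge0; exact: T_contr. Qed.

Let H_ge0 ws x : 0 <= rdot x (H ws *m x).
Proof. by rewrite rdot_H sumr_ge0. Qed.

Let H_kernel ws x : rdot x (H ws *m x) = 0 ->
  forall w, w \in ws -> sqnorm (T w *m x) = sqnorm x.
Proof.
rewrite rdot_H => sum0 w wws; apply/esym/eqP; rewrite -subr_eq0.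
move: sum0; rewrite (big_rem w)//= => /eqP.
by rewrite paddr_eq0 ?drop_ge0 ?sumr_ge0// => /andP[].
Qed.

Let H_kernelP ws x : (forall w, w \in ws -> sqnorm (T w *m x) = sqnorm x) ->
  H ws *m x = 0.
Proof.
move=> iso; rewrite /H mulmx_suml big_seq big1// => w wws.
by apply: defect_eq0; [exact: T_adj_contr | exact: iso].
Qed.

(* A rank-maximal finite sum of defects has the same kernel as the whole family. *)
Let maximal_rank : exists ws, (forall w, w \in ws -> W w) /\
  forall w, W w -> (\rank (H (w :: ws)) <= \rank (H ws))%N.
Proof.
apply: contrapT => none.
(* Otherwise the rank could be raised again and again, past the dimension [n]. *)
have /(_ n.+1)[ws [_]] : forall k, exists ws, (forall w, w \in ws -> W w) /\
    (k <= \rank (H ws))%N.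
  elim=> [|k [ws [Wws rk]]]; first by exists [::].
  apply: contrapT => small; apply: none; exists ws; split=> // w Ww.
  rewrite leqNgt; apply/negP => rk'; apply: small; exists (w :: ws).
  split=> [w'|]; last exact: leq_ltn_trans rk'.
  by rewrite inE => /predU1P[->|/Wws].
by rewrite leqNgt ltnS rank_leq_col.
Qed.

Lemma common_isometry_space : exists P delta (ws : seq (seq S)),
  [/\ orthoproj P,
      (forall w x, W w -> sqnorm (T w *m (P *m x)) = sqnorm (P *m x)),
      (forall w, W w -> P *m T w = T w *m P),
      (forall w, w \in ws -> W w) & 0 < delta /\
      forall x : 'cV_n, P *m x = 0 ->
        delta * sqnorm x <= \sum_(w <- ws) (sqnorm x - sqnorm (T w *m x))].
Proof.
have [ws [Wws ws_max]] := maximal_rank.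
have [|P [delta [oP d0 HP PH bound]]] := kernel_projection (H_adj ws) (H_ge0 ws).
  by move=> x /H_kernel/H_kernelP.
have isoP w x : W w -> sqnorm (T w *m (P *m x)) = sqnorm (P *m x).
  move=> Ww; apply: (@H_kernel (w :: ws)); last by rewrite mem_head.
  (* Row space inclusion is reversed kernel inclusion. Maximal rank turns it into equality, so
     [H (w :: ws)] factors through [H ws] and vanishes on the range of [P]. *)
  have sub : (H ws <= H (w :: ws))%MS.
    rewrite submxE; apply/eqP/mulmx_ext => y; rewrite mul0mx -mulmxA.
    apply: H_kernelP => w' w'ws; apply: (@H_kernel (w :: ws)).
      by rewrite (mulmxA (H _)) mulmx_coker mul0mx rdot0r.
    by rewrite inE w'ws orbT.
  have /leqifP := mxrank_leqif_sup sub; case: ifP => [|_].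
    move=> /submxP[D ->] _; rewrite -mulmxA (mulmxA (H ws)) HP.
    by rewrite mul0mx mulmx0 rdot0r.
  by rewrite ltnNge ws_max.
exists P, delta, ws; split=> //.
- move=> w Ww; apply: isometry_commutes_proj => //.
    (* The range of [P] is invariant: a word [w'] read after [w] still loses nothing, because
       [w ++ w'] lies in [W]. *)
    apply: mulmx_ext => x; rewrite -!mulmxA; apply: PH.
    apply: H_kernelP => w' /Wws Ww'; rewrite (mulmxA (T w')) -T_cat.
    by rewrite !isoP//; exact: W_cat.
  apply: mulmx_ext => x; rewrite mul0mx -mulmxA.
  by apply: defect_eq0; [exact: T_adj_contr | exact: isoP].
- by split=> // x /bound; rewrite rdot_H.
Qed.

Lemma T_flatten_nseqM k m w :
  T (flatten (nseq (k + m) w)) = T (flatten (nseq k w)) *m T (flatten (nseq m w)).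
Proof. by rewrite addnC nseqD flatten_cat T_cat. Qed.

Lemma W_flatten_nseq k w : W w -> W (flatten (nseq k w)).
Proof. by move=> Ww; elim: k => [|k IH] //=; exact: W_cat. Qed.

(** As long as the squared norm exceeds [eps], some word of [ws] removes a fixed amount of it, and
    this cannot go on forever. *)
Lemma shrinking_word (P : 'M[R[i]]_n) delta (ws : seq (seq S)) x eps :
  (forall w, W w -> P *m T w = T w *m P) -> (forall w, w \in ws -> W w) ->
  0 < delta -> 0 < eps -> P *m x = 0 ->
  (forall x : 'cV_n, P *m x = 0 ->
     delta * sqnorm x <= \sum_(w <- ws) (sqnorm x - sqnorm (T w *m x))) ->
  exists2 u, W u & sqnorm (T u *m x) <= eps.
Proof.
move=> PT Wws d0 e0 Px drop; apply: contrapT => none.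
have big u : W u -> eps < sqnorm (T u *m x).
  by move=> Wu; rewrite ltNge; apply/negP => small; apply: none; exists u.
(* The words of [ws] together lose at least [delta * eps], so one of them loses at least the
   average; the successor makes the comparison strict. *)
pose step := delta * eps / (size ws).+1%:R.
have step0 : 0 < step by rewrite divr_gt0 ?mulr_gt0.
have [k] : exists k : nat, sqnorm x < k%:R * step.
  exists (Num.truncn (sqnorm x / step)).+1.
  by rewrite -ltr_pdivrMr// truncnS_gt.
suff [u Wu] : exists2 u, W u & sqnorm (T u *m x) <= sqnorm x - k%:R * step.
  by move=> /(le_trans (sqnorm_ge0 _)); rewrite subr_ge0 leNgt => /negP.
elim: k => [|k [u Wu IH]].
  by exists [::]; rewrite // T_nil mul1mx mul0r subr0.
pose y := T u *m x.
have Py : P *m y = 0 by rewrite mulmxA PT// -mulmxA Px mulmx0.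
suff [w wws yw] : exists2 w, w \in ws & step <= sqnorm y - sqnorm (T w *m y).
  exists (u ++ w); first by apply: W_cat => //; exact: Wws.
  rewrite T_cat -mulmxA -/y -natr1 mulrDl mul1r.
  by move: IH yw; rewrite -/y; lra.
apply: contrapT => flat.
have : delta * eps <= (size ws)%:R * step.
  have : delta * eps <= delta * sqnorm y by rewrite ler_pM2l// ltW// big.
  move=> /le_trans; apply; apply: le_trans (drop _ Py) _.
  rewrite mulr_natl -sum1_size -sumrMnr big_seq [leRHS]big_seq.
  apply: ler_sum => w wws; rewrite mulr1n.
  by rewrite leNgt; apply/negP => /ltW yw; apply: flat; exists w.
rewrite leNgt => /negP; apply; rewrite /step mulrA ltr_pdivrMr// mulrC.
by rewrite ltr_pM2l ?mulr_gt0// ltr_nat.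
Qed.

(* r and N may depend on u: they serve to close up the word w ++ u in a finite
   automaton run in parallel. *)
Theorem recurrent_approx : exists P : 'M[R[i]]_n,
  [/\ orthoproj P,
      (forall w x, W w -> sqnorm (T w *m (P *m x)) = sqnorm (P *m x)) &
      forall w v eps, W w -> 0 < eps -> exists2 u, W u &
        forall r N, W r -> (0 < N)%N -> exists2 m, (0 < m)%N &
          sqnorm (T (flatten (nseq (m * N) (w ++ u ++ r))) *m v - P *m v) <= eps].
Proof.
have [P [delta [ws [oP isoP PT Wws [d0 drop]]]]] := common_isometry_space.
have [PP Pa] := oP.
exists P; split=> // w v eps Ww e0.
have e4 : 0 < eps / 4 by rewrite divr_gt0.
pose v2 := v - P *m v.
have Pv2 : P *m v2 = 0 by rewrite mulmxBr mulmxA PP subrr.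
have PTv2 : P *m (T w *m v2) = 0 by rewrite mulmxA PT// -mulmxA Pv2 mulmx0.
have [u Wu small] := shrinking_word PT Wws d0 e4 PTv2 drop.
exists u => // r N Wr N0; pose z := w ++ u ++ r.
have Wz : W z by do !apply: W_cat.
pose F k := T (flatten (nseq k z)).
have WF k : W (flatten (nseq k z)) by exact: W_flatten_nseq.
have PF k : P *m F k = F k *m P by exact: PT.
(* The powers of [z] keep [P v] in a bounded set, so two of them nearly agree; the common part
   [F (a * N)] is isometric on the range of [P] and cancels. *)
have [a [b [ab close]]] := @bounded_near_repeat R n
  (fun j => F (j * N)%N *m (P *m v)) (sqnorm (P *m v)) _ e4
  (fun j => T_contr _ _).
exists (b - a)%N; first by rewrite subn_gt0.
have -> : F ((b - a) * N)%N *m v - P *m v =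
    (F ((b - a) * N)%N *m (P *m v) - P *m v) + F ((b - a) * N)%N *m v2.
  by rewrite mulmxBr [RHS]addrC addrA subrK.
apply: le_trans (sqnormD_le2 _ _) _.
(* The first copy of [z] starts with [w ++ u], which already shrinks [v2]; all that follows is
   contracting. At least one copy occurs, as [a < b] and [0 < N]. *)
have : sqnorm (F ((b - a) * N)%N *m v2) <= eps / 4.
  apply: le_trans small; rewrite /F.
  have -> : ((b - a) * N)%N = (((b - a) * N).-1 + 1)%N.
    by rewrite addn1 prednK// muln_gt0 subn_gt0 ab.
  rewrite T_flatten_nseqM -mulmxA; apply: le_trans (T_contr _ _) _.
  by rewrite /= cats0 /z !T_cat -!mulmxA; exact: T_contr.
have : sqnorm (F ((b - a) * N)%N *m (P *m v) - P *m v) <= eps / 4.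
  rewrite sqnorm_distC; set y := P *m v - _.
  have Py : P *m y = y.
    rewrite mulmxBr (mulmxA P P) PP; congr (_ - _).
    by rewrite (mulmxA P (F _)) PF -mulmxA (mulmxA P P) PP.
  have := isoP _ y (WF (a * N)%N); rewrite Py => <-.
  move: close; congr (sqnorm _ <= _).
  rewrite mulmxBr; congr (_ - _); rewrite (mulmxA (T _) (F _)) -T_flatten_nseqM.
  by rewrite -mulnDl subnKC// ltnW.
lra.
Qed.

End ContractionMonoid.

(** * Finite automata *)

Section Automata.
Variable Sigma : finType.
Implicit Types (M : dfa Sigma) (L : seq Sigma -> Prop).

Lemma dfa_read_cat M (q : M) u v :
  dfa_read q (u ++ v) = dfa_read (dfa_read q u) v.
Proof. exact: foldl_cat. Qed.

Lemma dfa_read_nseq M (q : M) k w :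
  dfa_read q (flatten (nseq k w)) = iter k (fun r => dfa_read r w) q.
Proof. by elim: k q => //= k IH q; rewrite dfa_read_cat IH -iterSr. Qed.

(* Redirecting to q1 every transition into q2 gives a smaller automaton. The last
   hypothesis covers both an unreachable q2 and a q2 equivalent to q1. *)
Lemma minimal_no_merge M L (q1 q2 : M) w1 : minimal_dfa M L -> q1 != q2 ->
  q1 = dfa_read (dfa_start M) w1 ->
  (forall w, dfa_read (dfa_start M) w = q2 -> forall u,
     (dfa_read q1 u \in dfa_accept M) = (dfa_read q2 u \in dfa_accept M)) ->
  False.
Proof.
move=> [recM minM] q12 q1E merge.
pose st : finType := {q : M | q != q2}.
(* The default value of [insubd] does the redirecting: [q2] goes to [q1], any other state to
   itself. *)
pose pi (q : M) : st := insubd (exist _ q1 q12) q.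
pose M' : dfa Sigma := @Dfa Sigma st (pi (dfa_start M))
  [set q | val q \in dfa_accept M] (fun q s => pi (dfa_trans (val q) s)).
have piP v : (exists v', val (pi (dfa_read (dfa_start M) v)) = dfa_read (dfa_start M) v')
    /\ forall u, (dfa_read (val (pi (dfa_read (dfa_start M) v))) u \in dfa_accept M) =
                 (dfa_read (dfa_read (dfa_start M) v) u \in dfa_accept M).
  rewrite val_insubd; case: ifPn => [_|]; first by split=> //; exists v.
  rewrite negbK => /eqP vq2; split; first by exists w1.
  by move=> u; rewrite /= (merge v vq2) vq2.
(* Invariant of the merged run: its state is reachable in [M] and accepts the same continuations as
   the original one. Reachability lets [merge] be applied at the next letter. *)
have sim w : (exists v, val (dfa_read (dfa_start M') w) = dfa_read (dfa_start M) v) /\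
    forall u, (dfa_read (val (dfa_read (dfa_start M') w)) u \in dfa_accept M) =
              (dfa_read (dfa_read (dfa_start M) w) u \in dfa_accept M).
  elim/last_ind: w => [|w s [[v vE] accE]]; first exact: (piP [::]).
  rewrite -!cats1 dfa_read_cat [dfa_read _ [:: s]]/= vE.
  have [ex accE'] := piP (rcons v s).
  have vsE : dfa_trans (dfa_read (dfa_start M) v) s = dfa_read (dfa_start M) (rcons v s).
    by rewrite -cats1 dfa_read_cat.
  rewrite vsE; split=> // u; have := accE (s :: u); rewrite vE => wsu.
  by rewrite accE' -vsE dfa_read_cat.
have recM' : dfa_recognizes M' L.
  by move=> w; rewrite inE -[val _]/(dfa_read (val _) [::]) (sim w).2; exact: recM.
have := minM _ recM'; rewrite leqNgt => /negP; apply.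
by rewrite /= card_sig (cardC1 q2) ltn_predL; apply/card_gt0P; exists q2.
Qed.

Lemma minimal_reachable M L (q : M) : minimal_dfa M L ->
  exists w, q = dfa_read (dfa_start M) w.
Proof.
move=> minM; apply: contrapT => unreach.
apply: (minimal_no_merge minM (q2 := q) (w1 := [::]) _ erefl) => [|w wq].
  by apply/eqP => sq; apply: unreach; exists [::].
by case: unreach; exists w.
Qed.

Lemma minimal_distinguish M L (q1 q2 : M) : minimal_dfa M L -> q1 != q2 ->
  exists z, (dfa_read q1 z \in dfa_accept M) != (dfa_read q2 z \in dfa_accept M).
Proof.
move=> minM q12; apply: contrapT => same.
have [w q1E] := minimal_reachable q1 minM.
apply: (minimal_no_merge minM q12 q1E) => v _ u.
by apply/eqP/negP => /negP diff; apply: same; exists u.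
Qed.

(** The iterates of [f] are eventually periodic, uniformly in the point. All multiples of [N] are
    covered because [recurrent_approx] chooses [m] after [N]. *)
Lemma iter_idempotent (T : finType) (f : T -> T) : exists2 N, (0 < N)%N &
  forall m x, iter (m * N) f (iter (m * N) f x) = iter (m * N) f x.
Proof.
have [a [b [ab /ffunP fab]]] := pigeonhole (fun k => [ffun x => iter k f x]).
have per1 k x : (a <= k)%N -> iter (k + (b - a)) f x = iter k f x.
  move=> ak; rewrite -{1}(subnK ak) -addnA (subnKC (ltnW ab)) !iterD.
  by have := fab x; rewrite !ffunE => <-; rewrite -iterD subnK.
have per k l x : (a <= k)%N -> iter (k + l * (b - a)) f x = iter k f x.
  move=> ak; elim: l => [|l IH]; first by rewrite addn0.
  by rewrite mulSn addnCA addnC per1// (leq_trans ak)// leq_addr.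
(* A multiple of the period [b - a] that is at least the preperiod [a]; the successor keeps it
   positive when [a = 0]. *)
exists ((b - a) * a.+1)%N; first by rewrite muln_gt0 subn_gt0 ab.
case=> [|m] x //; rewrite -iterD [in X in (_ + X)%N]mulnCA [in X in (_ + X)%N]mulnC.
rewrite per// mulnCA (leq_trans (leqnSn a))// mulnA leq_pmull// muln_gt0 subn_gt0.
by rewrite ab.
Qed.

Lemma star3_nil (u v w : seq Sigma) : star3 u v w [::].
Proof. by exists [::]. Qed.

Lemma star3_cat (u v w s t : seq Sigma) :
  star3 u v w s -> star3 u v w t -> star3 u v w (s ++ t).
Proof.
move=> [ss sub_s ->] [ts sub_t ->]; exists (ss ++ ts); last by rewrite flatten_cat.
by move=> x; rewrite mem_cat => /orP[/sub_s|/sub_t].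
Qed.

Lemma star3_mem (u v w s : seq Sigma) : s \in [:: u; v; w] -> star3 u v w s.
Proof.
move=> s_in; exists [:: s]; last by rewrite /= cats0.
by move=> x; rewrite mem_seq1 => /eqP ->.
Qed.

End Automata.

(** * Quantum automata *)

Section HaltingProbability.
Variables (R : realType) (Sigma : finType) (A : qfa R Sigma).
Local Notation V := 'cV[R[i]]_#|qfa_state A|.
Implicit Types (x y : V) (u v : seq (tape_letter Sigma)).

Definition proj_mx (S : {set qfa_state A}) : 'M[R[i]]_#|qfa_state A| :=
  diag_mx (\row_k (enum_val k \in S)%:R).

Lemma span_projE S x : span_proj S x = proj_mx S *m x.
Proof.
apply/colP => k; rewrite mul_diag_colE !mxE.
by case: ifP; rewrite ?mul1r ?mul0r.
Qed.

Definition tape_mx u : 'M[R[i]]_#|qfa_state A| :=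
  foldr (fun s X => X *m (proj_mx (qfa_non A) *m qfa_op A s)) 1%:M u.

Lemma tape_mx_cat u v : tape_mx (u ++ v) = tape_mx v *m tape_mx u.
Proof. by elim: u => [|s u IH] /=; rewrite ?mulmx1// IH -mulmxA. Qed.

Lemma halt_prob_cat H x u v :
  halt_prob H x (u ++ v) = halt_prob H x u + halt_prob H (tape_mx u *m x) v.
Proof.
elim: u x => [|s u IH] x /=; first by rewrite mul1mx add0r.
by rewrite IH addrA !span_projE -!mulmxA.
Qed.

Lemma halt_prob_ge0 H x u : 0 <= halt_prob H x u.
Proof. by elim: u x => //= s u IH x; rewrite addr_ge0// sqnorm_ge0. Qed.

Lemma sqnorm_measure x :
  sqnorm (span_proj (qfa_acc A) x) + sqnorm (span_proj (qfa_rej A) x) +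
    sqnorm (span_proj (qfa_non A) x) = sqnorm x.
Proof.
rewrite /sqnorm -!big_split; apply: eq_bigr => k _; rewrite /= !mxE !inE.
have := disjointFr (qfa_disjoint A) (x := enum_val k).
case: (enum_val k \in qfa_acc A) => [->//|_] /=.
  by rewrite /= expr0n /= !addr0.
by case: (_ \in _); rewrite /= expr0n /= !(add0r, addr0).
Qed.

Lemma halt_prob_total x u :
  halt_prob (qfa_acc A) x u + halt_prob (qfa_rej A) x u +
    sqnorm (tape_mx u *m x) = sqnorm x.
Proof.
elim: u x => [|s u IH] x /=; first by rewrite mul1mx !add0r.
rewrite -!mulmxA -span_projE -(sqnorm_unitary x (qfa_op_unitary A s)).
have := IH (span_proj (qfa_non A) (qfa_op A s *m x)).
have := sqnorm_measure (qfa_op A s *m x); lra.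
Qed.

(** Accepting costs norm: a word that is isometric on [x] accepts nothing from [x]. *)
Lemma halt_acc_le x u :
  halt_prob (qfa_acc A) x u <= sqnorm x - sqnorm (tape_mx u *m x).
Proof.
have := halt_prob_total x u; have := halt_prob_ge0 (qfa_rej A) x u; lra.
Qed.

Lemma tape_mx_contraction u : contraction (tape_mx u).
Proof.
move=> x; have := halt_acc_le x u.
have := halt_prob_ge0 (qfa_acc A) x u; lra.
Qed.

Lemma sqnorm_proj_le S x : sqnorm (proj_mx S *m x) <= sqnorm x.
Proof.
rewrite -span_projE; apply: ler_sum => k _; rewrite mxE.
by case: ifP => //= _; rewrite expr0n /= addr0 addr_ge0 ?sqr_ge0.
Qed.

Lemma proj_mx_adj S : (proj_mx S)^t* = proj_mx S.
Proof.
rewrite diag_mx_adj; congr diag_mx; apply/rowP => k; rewrite !mxE.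
by case: (_ \in _); rewrite /= ?rmorph0 ?rmorph1.
Qed.

(** The adjoint of one step is a projection followed by a unitary map. *)
Lemma tape_mx_adj_contraction u : contraction ((tape_mx u)^t*).
Proof.
elim: u => [|s u IH] x /=; first by rewrite adjmx1 mul1mx.
rewrite !adjmxM proj_mx_adj -!mulmxA.
have Va : (qfa_op A s)^t* \is unitarymx by rewrite trmxC_unitary qfa_op_unitary.
rewrite (sqnorm_unitary _ Va); apply: le_trans (sqnorm_proj_le _ _) _.
exact: IH.
Qed.

(** Each halting term is a quadratic form, so Young's inequality applies letter by letter; one [t]
    serves all letters, and the bound does not degrade with the length of [u]. *)
Lemma halt_prob_add_le H x y u (t : R) : 0 < t ->
  halt_prob H (x + y) u <= (1 + t) * halt_prob H x u + (1 + t^-1) * halt_prob H y u.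
Proof.
move=> t0; elim: u x y => [|s u IH] x y /=; first by rewrite !mulr0 addr0.
rewrite !span_projE !mulmxDr.
have := IH (proj_mx (qfa_non A) *m (qfa_op A s *m x))
           (proj_mx (qfa_non A) *m (qfa_op A s *m y)).
have := sqnormD_le (proj_mx H *m (qfa_op A s *m x))
                   (proj_mx H *m (qfa_op A s *m y)) t0.
lra.
Qed.

Lemma halt_acc_continuous (eps : R) : 0 < eps -> exists2 delta, 0 < delta &
  forall x y u, sqnorm x <= 1 -> sqnorm y <= 1 -> sqnorm (x - y) <= delta ->
    `|halt_prob (qfa_acc A) x u - halt_prob (qfa_acc A) y u| <= eps.
Proof.
move=> e0; pose t := eps / 2; have t0 : 0 < t by rewrite divr_gt0.
have t1 : 0 < 1 + t^-1 by rewrite addr_gt0 ?invr_gt0.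
(* The factor [1 + t] costs at most [t], as probabilities are at most 1, and [1 + t^-1] times this
   radius is another [t]. *)
exists (t / (1 + t^-1)); first by rewrite divr_gt0.
have half x y u : sqnorm x <= 1 ->
    sqnorm (y - x) <= t / (1 + t^-1) ->
    halt_prob (qfa_acc A) y u <= halt_prob (qfa_acc A) x u + eps.
  move=> x1 xy; have := halt_prob_add_le (qfa_acc A) x (y - x) u t0.
  rewrite addrC subrK => /le_trans; apply.
  have hx : halt_prob (qfa_acc A) x u <= 1.
    have := halt_acc_le x u; have := sqnorm_ge0 (tape_mx u *m x); lra.
  have hy : halt_prob (qfa_acc A) (y - x) u <= t / (1 + t^-1).
    have := halt_acc_le (y - x) u; have := sqnorm_ge0 (tape_mx u *m (y - x)).
    lra.
  have -> : eps = t + t by rewrite /t; field.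
  rewrite mulrDl mul1r -addrA lerD2l; apply: lerD.
    by rewrite ler_piMr// ltW.
  by rewrite mulrC -ler_pdivlMr.
move=> x y u x1 y1 xy; rewrite ler_distl lerBlDr !half// sqnorm_distC//.
Qed.

End HaltingProbability.

(** * Bookkeeping of the errors *)

Section RealEstimates.
Variable R : realType.
Implicit Types r s x e : R.

Lemma quarter_le e : 0 <= e -> e / 4 <= e.
Proof. lra. Qed.

Lemma dist_add3 r s s' x x' e : `|s - s'| <= e -> `|x - x'| <= e ->
  `|r + (s + x) - (r + s' + x')| <= 2 * e.
Proof.
by rewrite !ler_distl => /andP[? ?] /andP[? ?]; apply/andP; split; lra.
Qed.

Lemma dist_detour_lt r s x x' e : 0 < e -> 0 <= s -> s <= e / 4 ->
  `|x - x'| <= e / 4 + e / 4 -> `|r + x - (r + (s + x'))| < e.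
Proof.
by rewrite ler_distl ltr_distl => ? ? ? /andP[? ?]; apply/andP; split; lra.
Qed.

(** The nine terms cancel cyclically in the sum of the three gaps. That sum is at least [3e], while
    the six errors amount to at most [3e/2]. *)
Lemma cyclic_gap_absurd (ra rb rc sd se sf tg th ti : R) (x y z x' y' z' e : R) :
  0 < e -> e <= x - x' -> e <= y - y' -> e <= z - z' ->
  `|x - (ra + sd + tg)| <= 2 * (e / 8) -> `|x' - (ra + se + th)| <= 2 * (e / 8) ->
  `|y - (rb + sf + th)| <= 2 * (e / 8) -> `|y' - (rb + sd + ti)| <= 2 * (e / 8) ->
  `|z - (rc + se + ti)| <= 2 * (e / 8) -> `|z' - (rc + sf + tg)| <= 2 * (e / 8) ->
  False.
Proof.
rewrite !ler_distl => ? ? ? ?.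
by do 6! [move=> /andP[? ?]]; lra.
Qed.

End RealEstimates.

(** * A minimal automaton and a quantum automaton for the same language *)

Section RecognizedLanguage.
Variables (R : realType) (Sigma : finType) (L : seq Sigma -> Prop) (M : dfa Sigma).
Hypothesis minM : minimal_dfa M L.
Variables (A : qfa R Sigma) (p : R).
Hypotheses (p_half : 2^-1 < p) (recA : qfa_recognizes A L p).
Local Notation V := 'cV[R[i]]_#|qfa_state A|.
Local Notation acc := (halt_prob (qfa_acc A)).
Local Notation letters := (map (@Letter Sigma)).

Let gap_gt0 : 0 < 2 * p - 1. Proof. by move: p_half; lra. Qed.

(** The endmarkers go into [start_vec] and [final], which leaves [T] multiplicative. *)
Let T (w : seq Sigma) : 'M[R[i]]_#|qfa_state A| := tape_mx A (letters w).
Let final (x : V) (w : seq Sigma) : R := acc x (rcons (letters w) Dollar).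
Let start_vec (w : seq Sigma) : V := tape_mx A (Kappa :: letters w) *m ket R (qfa_start A).

Let T_nil : T [::] = 1%:M. Proof. by []. Qed.
Let T_cat u v : T (u ++ v) = T v *m T u.
Proof. by rewrite /T map_cat tape_mx_cat. Qed.
Let T_contr w : contraction (T w). Proof. exact: tape_mx_contraction. Qed.
Let T_adj w : contraction ((T w)^t*).
Proof. exact: tape_mx_adj_contraction. Qed.

Lemma final_cat x u w :
  final x (u ++ w) = acc x (letters u) + final (T u *m x) w.
Proof. by rewrite /final map_cat rcons_cat halt_prob_cat. Qed.

Lemma sqnorm_ket (q : qfa_state A) : sqnorm (ket R q) = 1.
Proof.
rewrite /sqnorm (bigD1 (enum_rank q))//= big1 => [|k /negPf kq].
  by rewrite !mxE !eqxx /= expr1n expr0n /= !addr0.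
by rewrite !mxE kq /= expr0n /= addr0.
Qed.

Lemma start_vec_le1 w : sqnorm (start_vec w) <= 1.
Proof. by rewrite -(sqnorm_ket (qfa_start A)); exact: tape_mx_contraction. Qed.

(** The probability of accepting during the common prefix cancels, leaving at least
    [p - (1 - p)]. *)
Lemma acceptance_gap w x y :
  dfa_read (dfa_read (dfa_start M) w) x \in dfa_accept M ->
  dfa_read (dfa_read (dfa_start M) w) y \notin dfa_accept M ->
  2 * p - 1 <= final (start_vec w) x - final (start_vec w) y.
Proof.
have [recM _] := minM; have [inL outL] := recA.
rewrite -!dfa_read_cat => /recM/inL Ax yL.
have /outL Ry : ~ L (w ++ y) by move=> /recM; apply/negP.
have tapeE z : accept_prob A (w ++ z) =
    acc (ket R (qfa_start A)) (Kappa :: letters w) + final (start_vec w) z.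
  by rewrite /accept_prob /tape map_cat rcons_cat -cat_cons halt_prob_cat.
have : accept_prob A (w ++ y) + reject_prob A (w ++ y) <= 1.
  have := halt_prob_total (ket R (qfa_start A)) (tape (w ++ y)).
  have := sqnorm_ge0 (tape_mx A (tape (w ++ y)) *m ket R (qfa_start A)).
  by rewrite sqnorm_ket /accept_prob /reject_prob; lra.
move: Ax Ry; rewrite !tapeE; lra.
Qed.

Lemma final_continuous (eps : R) : 0 < eps -> exists2 delta, 0 < delta &
  forall (x y : V), sqnorm x <= 1 -> sqnorm y <= 1 -> sqnorm (x - y) <= delta ->
    (forall w, `|acc x (letters w) - acc y (letters w)| <= eps) /\
    (forall w, `|final x w - final y w| <= eps).
Proof.
move=> /(halt_acc_continuous A)[delta d0 close]; exists delta => // x y x1 y1 xy.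
by split=> w; apply: close.
Qed.

(** Quarters, because [sqnormD_le2] doubles each of two squared norms. *)
Lemma dist_via w (y z t : V) delta :
  sqnorm (y - z) <= delta / 4 -> sqnorm (T w *m z - t) <= delta / 4 ->
  sqnorm (T w *m y - t) <= delta.
Proof.
move=> yz zt; have -> : T w *m y - t = T w *m (y - z) + (T w *m z - t).
  by rewrite mulmxBr addrA subrK.
have := sqnormD_le2 (T w *m (y - z)) (T w *m z - t); have := T_contr w (y - z).
lra.
Qed.

Section Submonoid.
Variable W : seq Sigma -> Prop.
Hypotheses (W_nil : W [::]) (W_cat : forall u v, W u -> W v -> W (u ++ v)).

(* Both q and q2 can be reached from q by words acting as almost the identity on
   the state P v of the quantum automaton, which is therefore unable to tell
   q from q2. *)
Lemma recurrent_idempotent (q q2 : M) x : W x -> returns_under W q ->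
  dfa_read q x = q2 -> dfa_read q2 x = q2 -> q = q2.
Proof.
move=> Wx ret qx q2x; apply/eqP/negP => /negP q12.
have [z zE] := minimal_distinguish minM q12.
have [w1 qE] := minimal_reachable q minM.
have [P [oP isoP approx]] := recurrent_approx T_nil T_cat T_contr T_adj W_nil W_cat.
have [PP _] := oP.
set v := start_vec w1.
have v1 : sqnorm v <= 1 by exact: start_vec_le1.
have Pv1 : sqnorm (P *m v) <= 1.
  by have := orthoproj_split v oP; have := sqnorm_ge0 (v - P *m v); lra.
have e0 : 0 < (2 * p - 1) / 4 by rewrite divr_gt0 ?gap_gt0.
have [delta d0 cont] := final_continuous e0.
have d4 : 0 < delta / 4 by rewrite divr_gt0.
have [u Wu appu] := approx [::] v _ W_nil d4.
have [r Wr qur] := ret u Wu.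
have [m m0 small] := appu r 1%N Wr isT.
pose t := flatten (nseq (m * 1) ([::] ++ u ++ r)).
have qt : dfa_read q t = q.
  by rewrite dfa_read_nseq; apply: iter_fix; rewrite !dfa_read_cat.
have [u' Wu' appu'] := approx x (P *m v) _ Wx d4.
have [r' Wr' qr'] := ret (x ++ u') (W_cat Wx Wu').
(* Closing with [r' ++ x] makes the word end in [q2], from [q] as well as from [q2], while its power
   moves [P v] only slightly. *)
have [m' m'0 small'] := appu' (r' ++ x) 1%N (W_cat Wr' Wx) isT.
pose t' := flatten (nseq (m' * 1) (x ++ u' ++ r' ++ x)).
have qur' s : dfa_read s x = q2 -> dfa_read s (x ++ u' ++ r' ++ x) = q2.
  move=> sx; move: qr'; rewrite !dfa_read_cat sx qx => ->; exact: qx.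
have qt' : dfa_read q t' = q2.
  rewrite dfa_read_nseq muln1 -(prednK m'0) iterSr qur'//.
  by apply: iter_fix; apply: qur'.
rewrite (mulmxA P P) PP in small'.
pose y := T t *m v; pose y' := T t' *m y.
have y1 : sqnorm y <= 1 by exact: le_trans (T_contr _ _) v1.
have y'1 : sqnorm y' <= 1 by exact: le_trans (T_contr _ _) y1.
have yP : sqnorm (y - P *m v) <= delta.
  exact: le_trans small (quarter_le (ltW d0)).
have y'P : sqnorm (y' - P *m v) <= delta := dist_via small small'.
have [accy finy] := cont _ _ y1 Pv1 yP.
have [_ finy'] := cont _ _ y'1 Pv1 y'P.
(* [t'] is isometric on [P v], hence accepts nothing there; by continuity it accepts little from
   [y]. *)
have accP : acc (P *m v) (letters t') <= 0.
  have := halt_acc_le (P *m v) (letters t').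
  rewrite -/(T t') isoP ?subrr//; apply: W_flatten_nseq => //.
  by do !apply: W_cat.
have acc_ge := halt_prob_ge0 (qfa_acc A) y (letters t').
have acc_le : acc y (letters t') <= (2 * p - 1) / 4.
  by move: (accy t'); rewrite ler_distl => /andP[_ /le_trans]; apply; rewrite gerDr.
have E1 : final v (t ++ z) = acc v (letters t) + final y z by rewrite final_cat.
have E2 : final v (t ++ t' ++ z) = acc v (letters t) + (acc y (letters t') + final y' z).
  by rewrite !final_cat.
(* The runs on [t ++ z] and [t ++ t' ++ z] read [z] in [q] and [q2], yet their acceptance differs by
   at most three quarters of the gap. *)
have close : `|final v (t ++ z) - final v (t ++ t' ++ z)| < 2 * p - 1.
  rewrite E1 E2; apply: dist_detour_lt => //.
  by apply: le_trans (ler_distD _ _ _) (lerD (finy z) _); rewrite distrC.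
move: close; rewrite ltNge => /negP; apply.
case zq : (dfa_read q z \in dfa_accept M) zE;
  case zq2 : (dfa_read q2 z \in dfa_accept M) => // _.
  apply: le_trans (ler_norm _).
  by apply: acceptance_gap; rewrite -qE !dfa_read_cat qt ?qt' ?zq ?zq2.
rewrite distrC; apply: le_trans (ler_norm _).
by apply: acceptance_gap; rewrite -qE !dfa_read_cat qt ?qt' ?zq ?zq2.
Qed.

(** [y] is a power of [x ++ u] acting idempotently on the states. Its leading [x] merges [q] with
    [q'], and [recurrent_idempotent] makes [y] fix [q']. One [y] serves all pairs [q], [q'], and [P]
    depends on neither [x] nor [v]. *)
Lemma projecting_word : exists2 P : 'M[R[i]]_#|qfa_state A|, orthoproj P &
  forall x (v : V) eps, W x -> 0 < eps -> exists2 y,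
    sqnorm (T y *m v - P *m v) <= eps &
    forall q q' : M, returns_under W q' -> dfa_read q x = q' ->
      dfa_read q' x = q' -> dfa_read q y = q'.
Proof.
have [P [oP _ approx]] := recurrent_approx T_nil T_cat T_contr T_adj W_nil W_cat.
exists P => // x v eps Wx e0.
have [u Wu appu] := approx x v eps Wx e0.
have [N N0 idem] := iter_idempotent (fun q : M => dfa_read q (x ++ u ++ [::])).
have [m m0 small] := appu [::] N W_nil N0.
exists (flatten (nseq (m * N) (x ++ u ++ [::]))) => // q q' ret qx q'x.
have -> : dfa_read q (flatten (nseq (m * N) (x ++ u ++ [::]))) =
          dfa_read q' (flatten (nseq (m * N) (x ++ u ++ [::]))).
  have : (0 < m * N)%N by rewrite muln_gt0 m0.
  by case: (m * N)%N => // k _; rewrite /= -!catA !(dfa_read_cat _ x) qx q'x.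
symmetry; apply: recurrent_idempotent ret erefl _.
  by apply: W_flatten_nseq => //; do !apply: W_cat.
by rewrite !dfa_read_nseq idem.
Qed.

End Submonoid.

(** Replacing the true vectors by [P v] and [P' P v] frees the second term from [u] and the third
    from [u] and [u'], at a cost of [eps] each. *)
Lemma two_stage_final (P P' : 'M[R[i]]_#|qfa_state A|) (v : V) delta eps u u' g :
  orthoproj P -> orthoproj P' -> sqnorm v <= 1 ->
  (forall x y : V, sqnorm x <= 1 -> sqnorm y <= 1 -> sqnorm (x - y) <= delta ->
    (forall w, `|acc x (letters w) - acc y (letters w)| <= eps) /\
    (forall w, `|final x w - final y w| <= eps)) ->
  0 < delta ->
  sqnorm (T u *m v - P *m v) <= delta / 4 ->
  sqnorm (T u' *m (P *m v) - P' *m (P *m v)) <= delta / 4 ->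
  `|final v (u ++ u' ++ g) -
    (acc v (letters u) + acc (P *m v) (letters u') + final (P' *m (P *m v)) g)|
  <= 2 * eps.
Proof.
move=> oP oP' v1 cont d0 uv u'v.
have proj1 (Q : 'M[R[i]]_#|qfa_state A|) (x : V) :
    orthoproj Q -> sqnorm x <= 1 -> sqnorm (Q *m x) <= 1.
  by move=> /(orthoproj_split x); have := sqnorm_ge0 (x - Q *m x); lra.
have Pv1 := proj1 _ _ oP v1; have P'v1 := proj1 _ _ oP' Pv1.
have Tv1 : sqnorm (T u *m v) <= 1 by exact: le_trans (T_contr _ _) v1.
have TTv1 : sqnorm (T u' *m (T u *m v)) <= 1 by exact: le_trans (T_contr _ _) Tv1.
have uv' : sqnorm (T u *m v - P *m v) <= delta.
  exact: le_trans uv (quarter_le (ltW d0)).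
have [close_acc _] := cont _ _ Tv1 Pv1 uv'.
have [_ close_fin] := cont _ _ TTv1 P'v1 (dist_via uv u'v).
by rewrite !final_cat; exact: dist_add3.
Qed.

End RecognizedLanguage.

Theorem theorem4p1 (R : realType) (Sigma : finType) (L : seq Sigma -> Prop)
    (M : dfa Sigma) (HM : minimal_dfa M L)
    (a b c d e f g h i : seq Sigma)
    (q0 qa qb qc qad qae qbd qbf qce qcf : M)
    (H1 : dfa_read q0 a = qa /\ dfa_read q0 b = qb /\ dfa_read q0 c = qc)
    (H2 : dfa_read qa a = qa /\ dfa_read qb b = qb /\ dfa_read qc c = qc)
    (H3 : returns_under (star3 a b c) qa /\
          returns_under (star3 a b c) qb /\
          returns_under (star3 a b c) qc)
    (H4 : dfa_read qa d = qad /\ dfa_read qa e = qae /\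
          dfa_read qb d = qbd /\ dfa_read qb f = qbf /\
          dfa_read qc e = qce /\ dfa_read qc f = qcf)
    (H5 : dfa_read qad d = qad /\ dfa_read qae e = qae /\
          dfa_read qbd d = qbd /\ dfa_read qbf f = qbf /\
          dfa_read qce e = qce /\ dfa_read qcf f = qcf)
    (H6 : returns_under (star3 d e f) qad /\
          returns_under (star3 d e f) qae /\
          returns_under (star3 d e f) qbd /\
          returns_under (star3 d e f) qbf /\
          returns_under (star3 d e f) qce /\
          returns_under (star3 d e f) qcf)
    (H7acc : dfa_read qad g \in dfa_accept M /\
             dfa_read qbf h \in dfa_accept M /\
             dfa_read qce i \in dfa_accept M)
    (H7rej : dfa_read qae h \notin dfa_accept M /\
             dfa_read qbd i \notin dfa_accept M /\
             dfa_read qcf g \notin dfa_accept M) :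
  ~ qfa_recognizable R L.
Proof.
move=> [A [p [p_half recA]]].
have [w0 q0E] := minimal_reachable q0 HM.
have [P oP projP] := projecting_word HM p_half recA
  (star3_nil a b c) (@star3_cat _ a b c).
have [P' oP' projP'] := projecting_word HM p_half recA
  (star3_nil d e f) (@star3_cat _ d e f).
pose v := tape_mx A (Kappa :: map (@Letter Sigma) w0) *m ket R (qfa_start A).
have v1 : sqnorm v <= 1 by exact: start_vec_le1.
have eta0 : 0 < 2 * p - 1 by move: p_half; lra.
have eps0 : 0 < (2 * p - 1) / 8 by rewrite divr_gt0.
have [delta delta0 cont] := final_continuous A eps0.
have d4 : 0 < delta / 4 by rewrite divr_gt0.
have Wa : star3 a b c a by apply: star3_mem; rewrite !inE eqxx ?orbT.
have Wb : star3 a b c b by apply: star3_mem; rewrite !inE eqxx ?orbT.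
have Wc : star3 a b c c by apply: star3_mem; rewrite !inE eqxx ?orbT.
have Wd : star3 d e f d by apply: star3_mem; rewrite !inE eqxx ?orbT.
have We : star3 d e f e by apply: star3_mem; rewrite !inE eqxx ?orbT.
have Wf : star3 d e f f by apply: star3_mem; rewrite !inE eqxx ?orbT.
have [ua ua_close /(_ q0 qa) ua_read] := projP a v _ Wa d4.
have [ub ub_close /(_ q0 qb) ub_read] := projP b v _ Wb d4.
have [uc uc_close /(_ q0 qc) uc_read] := projP c v _ Wc d4.
(* These words are built for [P v], the common approximation after [ua], [ub] and [uc]; so a single
   [ud] serves after both [ua] and [ub], and likewise for [ue] and [uf]. *)
have [ud ud_close ud_read] := projP' d (P *m v) _ Wd d4.
have [ue ue_close ue_read] := projP' e (P *m v) _ We d4.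
have [uf uf_close uf_read] := projP' f (P *m v) _ Wf d4.
case: H1 H2 H3 => [q0a [q0b q0c]] [qaa [qbb qcc]] [ret_a [ret_b ret_c]].
have {}ua_read := ua_read ret_a q0a qaa.
have {}ub_read := ub_read ret_b q0b qbb.
have {}uc_read := uc_read ret_c q0c qcc.
case: H4 => [qa_d [qa_e [qb_d [qb_f [qc_e qc_f]]]]].
case: H5 => [qad_d [qae_e [qbd_d [qbf_f [qce_e qcf_f]]]]].
case: H6 => [rad [rae [rbd [rbf [rce rcf]]]]].
case: H7acc H7rej => [adg [bfh cei]] [aeh [bdi cfg]].
have estimate u u' z := two_stage_final (u := u) (u' := u') z
  oP oP' v1 cont delta0.
have gap x y : dfa_read q0 x \in dfa_accept M -> dfa_read q0 y \notin dfa_accept M ->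
    2 * p - 1 <= halt_prob (qfa_acc A) v (rcons (map (@Letter Sigma) x) Dollar) -
                 halt_prob (qfa_acc A) v (rcons (map (@Letter Sigma) y) Dollar).
  by rewrite q0E; apply: (acceptance_gap HM recA).
have := gap (ua ++ ud ++ g) (ua ++ ue ++ h).
have := gap (ub ++ uf ++ h) (ub ++ ud ++ i).
have := gap (uc ++ ue ++ i) (uc ++ uf ++ g).
rewrite !dfa_read_cat ua_read ub_read uc_read.
rewrite (ud_read _ _ rad qa_d qad_d) (ue_read _ _ rae qa_e qae_e).
rewrite (ud_read _ _ rbd qb_d qbd_d) (uf_read _ _ rbf qb_f qbf_f).
rewrite (ue_read _ _ rce qc_e qce_e) (uf_read _ _ rcf qc_f qcf_f).
move=> /(_ cei cfg) gap_c /(_ bfh bdi) gap_b /(_ adg aeh) gap_a.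
move: (estimate ua ud g ua_close ud_close) (estimate ua ue h ua_close ue_close)
  (estimate ub uf h ub_close uf_close) (estimate ub ud i ub_close ud_close)
  (estimate uc ue i uc_close ue_close) (estimate uc uf g uc_close uf_close).
exact: cyclic_gap_absurd eta0 gap_a gap_b gap_c.
Qed.
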